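(* For every $n\ge 1$: (a) $|I_n(010,101,120,201)|=|I_n(011,201)|$. (b) Let $C$ be any of the classes $I_n(010,101,120,201)$, $I_n(010,110,120,210)$, $I_n(010,100,120,210)$. For $e\in C$ let $a(e)$ be the number of entries equal to $0$, $b(e)$ the number of left-to-right maxima, $c(e)$ the bounce, and $d(e)$ the number of high entries. For $e\in I_n(011,201)$ let $x(e)$ be the number of high entries, $y(e)$ the number of entries equal to $0$, $z(e)$ the number of right-to-left minima, and $t(e)$ the bounce. Then the quadruple of statistics $(a,b,c,d)$ on $C$ has the same joint distribution as the quadruple $(x,y,z,t)$ on $I_n(011,201)$; i.e. for every quadruple $q$ of integers, $|\{e\in C:(a,b,c,d)(e)=q\}|=|\{e\in I_n(011,201):(x,y,z,t)(e)=q\}|$. Moreover, $a$ can be switched with $c$, and $x$ with $z$ (that is, $(a,b,c,d)$ and $(c,b,a,d)$ have the same joint distribution on $C$, and $(x,y,z,t)$ and $(z,y,x,t)$ have the same joint distribution on $I_n(011,201)$).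
   Context: An inversion sequence of length $n$ is an integer sequence $e=(e_1,\dots,e_n)$ with $0\le e_j\le j-1$. $e$ contains a pattern $f=(f_1,\dots,f_m)$ if there are indices $i_1<\dots<i_m$ with $e_{i_a}<e_{i_b}$ iff $f_a<f_b$ and $e_{i_a}=e_{i_b}$ iff $f_a=f_b$ for all $a,b$; otherwise it avoids $f$. $I_n(T)$ is the set of inversion sequences of length $n$ avoiding all patterns in $T$. An entry $e_j$ is high if $e_j=j-1$. The bounce of $e$ is $n-M$ where $M=\max_j e_j$. An entry $e_j$ is a left-to-right maximum if $e_j>e_i$ for all $i<j$ (in particular $e_1$ is one), and a right-to-left minimum if $e_j<e_k$ for all $k>j$ (in particular $e_n$ is one). *)

(* Defs.v *)
From mathcomp Require Import all_boot.

Set Implicit Arguments.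
Unset Strict Implicit.
Unset Printing Implicit Defensive.

(* Sequences of length n are 0-indexed: e_j of the text is e (j - 1), so the
   constraint e_j <= j - 1 reads e j <= j.  It forces every entry to be < n,
   hence the finite codomain 'I_n loses nothing. *)
Definition inversion_seq (n : nat) (e : {ffun 'I_n -> 'I_n}) : bool :=
  [forall j, e j <= j].

(* A pattern is a word of naturals; s a is the position in e of its letter a. *)
Definition contains (n : nat) (e : {ffun 'I_n -> 'I_n}) (f : seq nat) : bool :=
  [exists s : {ffun 'I_(size f) -> 'I_n},
    [forall a : 'I_(size f), forall b : 'I_(size f), (a < b) ==> (s a < s b)] &&
    [forall a : 'I_(size f), forall b : 'I_(size f),
       ((e (s a) < e (s b)) == (nth 0 f a < nth 0 f b)) &&
       ((e (s a) == e (s b)) == (nth 0 f a == nth 0 f b))]].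

Definition avoids (n : nat) (e : {ffun 'I_n -> 'I_n}) (f : seq nat) : bool :=
  ~~ contains e f.

Definition inv_avoiding (n : nat) (T : seq (seq nat)) :
    {set {ffun 'I_n -> 'I_n}} :=
  [set e : {ffun 'I_n -> 'I_n} | inversion_seq e && all (avoids e) T].

Section Statistics.
Variables (n : nat) (e : {ffun 'I_n -> 'I_n}).

Definition zeros : nat := #|[set j | e j == 0 :> nat]|.

Definition high_entries : nat := #|[set j | e j == j]|.

(* Every entry is < n, so for n > 0 the subtraction is not truncated. *)
Definition bounce : nat := n - \max_(j < n) e j.

Definition lr_maxima : nat :=
  #|[set j : 'I_n | [forall i : 'I_n, (i < j) ==> (e i < e j)]]|.

Definition rl_minima : nat :=
  #|[set j : 'I_n | [forall k : 'I_n, (j < k) ==> (e j < e k)]]|.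

End Statistics.

Definition equidistributed (S : finType) (V : eqType) (A B : {set S})
    (f g : S -> V) : Prop :=
  forall q : V, #|[set e in A | f e == q]| = #|[set e in B | g e == q]|.

Definition T_010_101_120_201 : seq (seq nat) :=
  [:: [:: 0; 1; 0]; [:: 1; 0; 1]; [:: 1; 2; 0]; [:: 2; 0; 1]].
Definition T_010_110_120_210 : seq (seq nat) :=
  [:: [:: 0; 1; 0]; [:: 1; 1; 0]; [:: 1; 2; 0]; [:: 2; 1; 0]].
Definition T_010_100_120_210 : seq (seq nat) :=
  [:: [:: 0; 1; 0]; [:: 1; 0; 0]; [:: 1; 2; 0]; [:: 2; 1; 0]].
Definition T_011_201 : seq (seq nat) :=
  [:: [:: 0; 1; 1]; [:: 2; 0; 1]].

(* Main.v *)
Require Import Defs.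
From mathcomp Require Import all_boot.
From mathcomp Require Import zify.

(* Both kinds of sequences are grown by appending a last entry.  For the classes
   C the tree has states (c, q), q the bounce and c + 1 the number of letters
   not exceeding the maximum that can be appended, with children (i, q + 1) for
   i <= c and (i, q - i) for i < q.  Cutting before each left-to-right maximum
   turns it into Dyck paths whose valleys, with d down and u up steps, have
   weight 'C(d + u - 2, d - 1); bounce, left-to-right maxima, zeros and high
   entries become final descent, peaks, initial ascent and returns.  This weight
   is symmetric, so reversing the paths exchanges the bounce with the number of
   zeros.
     For I_n(011,201), c counts the nonzero letters below the maximum that can be
   appended, and the children are (c + i, q - i) for i < q, (i, q + 1) for i < c,
   and (0, q + 1) for a new zero.  Deleting the initial run of high entries, so
   that the second zero comes first, lowers q by one.  The lowered word has h
   high entries, for some m <= h: the last m of them are high entries already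
   before lowering, and each of the others comes from a possibly empty run of
   high entries followed by the letter just below that run.  The bounce drops
   by one exactly when m = 0.  Removing the last valley of a weighted Dyck path
   obeys the same recursion, [peel_rec] below.
     To compare joint distributions, an arbitrary function of the four
   statistics is summed over all the sequences. *)

Set Implicit Arguments.
Unset Strict Implicit.
Unset Printing Implicit Defensive.

(** * Weighted Dyck paths *)

Definition weight := nat -> nat -> nat -> nat -> nat.

Definition succ_weight (g : weight) : weight := fun h z r b => g h.+1 z.+1 r.+1 b.+1.

Definition swap_weight (g : weight) : weight := fun h z r b => g r z h b.

(* The arguments of a weight are final descent, peaks, initial ascent and
   returns of a path, each minus one; [peel D g] sums [g] over the paths obtained
   by appending a valley at height m followed by D + 1 up steps. *)
Definition peel D (g : weight) : weight := fun h z r b =>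
  \sum_(m < h.+1) 'C(h - m + D, D) * g (m + D) z.+1 r (b + (m == 0 :> nat)).

(** The sum of [g] over weighted Dyck paths with [n.+1] up steps obeys this: a path has a single
    peak, or removing its last valley leaves [k.+1] up steps. Paths enter only through this
    recursion. *)
Definition peel_rec (X : nat -> weight -> nat) : Prop :=
  forall n g, X n g = g n 0 n 0 + \sum_(k < n) X k (peel (n - k.+1) g).

Lemma eq_peel D f g : (forall h z r b, f h z r b = g h z r b) ->
  forall h z r b, peel D f h z r b = peel D g h z r b.
Proof. by move=> fg h z r b; apply: eq_bigr => m _; rewrite fg. Qed.

Lemma peel_rec_ext X n f g : peel_rec X ->
  (forall h z r b, f h z r b = g h z r b) -> X n f = X n g.
Proof.
move=> Xrec; elim/ltn_ind: n f g => n IH f g fg; rewrite !Xrec fg.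
by congr (_ + _); apply: eq_bigr => k _; apply: IH => //; apply: eq_peel.
Qed.

Lemma peel_rec_unique X Y n g : peel_rec X -> peel_rec Y -> X n g = Y n g.
Proof.
move=> Xrec Yrec; elim/ltn_ind: n g => n IH g; rewrite Xrec Yrec.
by congr (_ + _); apply: eq_bigr => k _; apply: IH.
Qed.

(* [peel] acts on the last valley of the path, its conjugate by [swap_weight]
   on the first one, so that the two commute. *)
Lemma peel_swapC D E g h z r b :
  peel D (swap_weight (peel E g)) h z r b =
  swap_weight (peel E (swap_weight (peel D (swap_weight g)))) h z r b.
Proof.
rewrite /swap_weight /peel.
under eq_bigr do rewrite big_distrr /=.
rewrite exchange_big /=; apply: eq_bigr => i _.
rewrite big_distrr /=; apply: eq_bigr => j _.
by rewrite mulnCA addnAC.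
Qed.

Lemma triangle_sum n (G : nat -> nat -> nat) :
  \sum_(k < n) \sum_(j < k.+1) G j k = \sum_(j < n) \sum_(k < n - j) G j (j + k).
Proof.
elim: n => [|n IH]; first by rewrite !big_ord0.
rewrite big_ord_recr /= IH.
have -> : \sum_(j < n) \sum_(k < n - j) G j (j + k) =
          \sum_(j < n.+1) \sum_(k < n - j) G j (j + k).
  by rewrite [RHS]big_ord_recr /= subnn big_ord0 addn0.
rewrite -big_split; apply: eq_bigr => j _.
have jn : j <= n by rewrite -ltnS.
by rewrite subSn // big_ord_recr /= subnKC.
Qed.

Lemma triangle_sum_lt n (G : nat -> nat -> nat) :
  \sum_(k < n) \sum_(j < k) G j k =
  \sum_(j < n) \sum_(k < n - j.+1) G j (j.+1 + k).
Proof.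
case: n => [|n]; first by rewrite !big_ord0.
rewrite big_ord_recl big_ord0 add0n [RHS]big_ord_recr /= subnn big_ord0 addn0.
exact: (triangle_sum n (fun j k => G j k.+1)).
Qed.

(** Paths with exactly one valley: [m] is its height, with [d.+1] down steps and [n - m - d] up
    steps around it. *)
Lemma sum_one_valley n (g : weight) :
  \sum_(k < n) peel (n - k.+1) g k 0 k 0 =
  \sum_(m < n) \sum_(d < n - m)
    'C(d + (n - m - d.+1), d) * g (m + (n - m - d.+1)) 1 (m + d) (m == 0 :> nat).
Proof.
rewrite (triangle_sum n (fun m k => 'C(k - m + (n - k.+1), n - k.+1) *
   g (m + (n - k.+1)) 1 k (0 + (m == 0 :> nat)))).
apply: eq_bigr => m _; apply: eq_bigr => d _; rewrite addKn -addnS subnDA.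
by rewrite -(bin_sub (leq_addl _ _)) addnK.
Qed.

(** Reversal keeps the height of the valley and exchanges its down and up steps, under which the
    binomial is symmetric. *)
Lemma sum_one_valley_swap n (g : weight) :
  \sum_(k < n) peel (n - k.+1) g k 0 k 0 =
  \sum_(k < n) peel (n - k.+1) (swap_weight g) k 0 k 0.
Proof.
rewrite !sum_one_valley; apply: eq_bigr => m _.
rewrite (reindex_inj rev_ord_inj) /=; apply: eq_bigr => d _.
have dn := ltn_ord d; rewrite /swap_weight.
have -> : n - m - (n - m - d.+1).+1 = d by lia.
by rewrite -(bin_sub (leq_addr _ _)) addKn addnC.
Qed.

(** Paths with at most one valley are reversed by hand. Any other path loses its last valley, then
    also its first: the induction hypothesis reverses what remains, and the recursion is applied
    again. The two removals commute by [peel_swapC]. *)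
Lemma peel_rec_swap X n g : peel_rec X -> X n g = X n (swap_weight g).
Proof.
move=> Xrec; elim/ltn_ind: n g => n IH g.
have expand f : X n f = f n 0 n 0 + (\sum_(k < n) peel (n - k.+1) f k 0 k 0 +
  \sum_(j < n) \sum_(d < n - j.+1)
     X j (peel d (swap_weight (peel (n - j.+1 - d.+1) f)))).
  rewrite Xrec; congr (_ + _).
  have -> : \sum_(j < n) \sum_(d < n - j.+1)
      X j (peel d (swap_weight (peel (n - j.+1 - d.+1) f))) =
    \sum_(k < n) \sum_(j < k) X j (peel (k - j.+1) (swap_weight (peel (n - k.+1) f))).
    rewrite (triangle_sum_lt n (fun j k =>
      X j (peel (k - j.+1) (swap_weight (peel (n - k.+1) f))))).
    by apply: eq_bigr => j _; apply: eq_bigr => d _; rewrite addKn -addnS subnDA.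
  rewrite -big_split; apply: eq_bigr => k _ /=.
  by rewrite (IH k) // Xrec.
rewrite !expand sum_one_valley_swap; congr (_ + (_ + _)).
apply: eq_bigr => j _.
(* The numbers of up steps removed with the two valleys trade places; then the middle part is
   reversed. *)
rewrite (reindex_inj rev_ord_inj) /=; apply: eq_bigr => d _.
have -> : n - j.+1 - (n - j.+1 - d.+1).+1 = d by have := ltn_ord d; lia.
rewrite (IH j) //; apply: peel_rec_ext => // h z r b.
by rewrite {1}/swap_weight peel_swapC.
Qed.

(** * The generating tree of 011, 201 *)

(** The number of ways to distribute [d] high entries over [u] possibly empty runs; the predecessor
    makes it 1 for [u = d = 0]. *)
Definition slots u d := 'C((u + d).-1, d).

Lemma slots0 d : slots 0 d = (d == 0).
Proof. by case: d => [|d]; rewrite /slots ?bin0 // add0n bin_small. Qed.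

Lemma slots_pascal u d : slots u.+1 d.+1 = slots u d.+1 + slots u.+1 d.
Proof. by rewrite /slots addSn addnS /= binS. Qed.

Lemma slotsS u d : slots u.+1 d = \sum_(r < d.+1) slots u (d - r).
Proof.
rewrite (reindex_inj rev_ord_inj) /=.
rewrite (eq_bigr (fun r : 'I_d.+1 => slots u r)) => [|r _]; last first.
  by rewrite subSS subKn // -ltnS.
elim: d => [|d IH]; first by rewrite big_ord1 /slots !bin0.
by rewrite big_ord_recr /= -IH slots_pascal addnC.
Qed.

Lemma sum_slots c d : \sum_(i < c.+1) slots i.+1 d = slots c.+1 d.+1.
Proof.
elim: c => [|c IH]; first by rewrite big_ord1 /slots !add1n !binn.
by rewrite big_ord_recr /= IH [RHS]slots_pascal.
Qed.

(* [h] and [z] count the high entries and the zeros, each minus one.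
   The list [s] has one member for each right-to-left minimum: the number of
   letters counted by [c] that are smaller. *)
Fixpoint treeB n c q s h z (f : weight) : nat :=
  if n is n'.+1 then
    \sum_(i < q) treeB n' (c + i) (q - i) (rcons s (c + i)) (h + (i.+1 == q)) z f
    + \sum_(i < c) treeB n' i q.+1 (rcons [seq x <- s | x <= i] i) h z f
    + treeB n' 0 q.+1 [:: 0] h z.+1 f
  else f h z (size s).-1 q.-1.

Lemma treeB_ext n c q s h z f g : 0 < q ->
  (forall h z r b, f h z r b = g h z r b) ->
  treeB n c q s h z f = treeB n c q s h z g.
Proof.
move=> + fg; elim: n c q s h z => [|n IH] c q s h z q0 /=; first exact: fg.
congr (_ + _ + _); try apply: eq_bigr => i _; apply: IH => //.
by rewrite subn_gt0.
Qed.

Lemma treeB_sum n c q s h z m (f : nat -> weight) :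
  treeB n c q s h z (fun h z r b => \sum_(i < m) f i h z r b) =
  \sum_(i < m) treeB n c q s h z (f i).
Proof.
elim: n c q s h z => [|n IH] c q s h z //=.
rewrite !big_split /= IH; congr (_ + _ + _).
  by rewrite exchange_big; apply: eq_bigr => i _; rewrite IH.
by rewrite exchange_big; apply: eq_bigr => i _; rewrite IH.
Qed.

Lemma treeB_add n c q s h z f g :
  treeB n c q s h z (fun h z r b => f h z r b + g h z r b) =
  treeB n c q s h z f + treeB n c q s h z g.
Proof.
elim: n c q s h z => [|n IH] c q s h z //=.
under eq_bigr do rewrite IH.
under [X in _ + X + _]eq_bigr do rewrite IH.
by rewrite IH !big_split /=; lia.
Qed.

Lemma treeB_scale n c q s h z a f :
  treeB n c q s h z (fun h z r b => a * f h z r b) = a * treeB n c q s h z f.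
Proof.
elim: n c q s h z => [|n IH] c q s h z //=.
by rewrite !mulnDr IH !big_distrr /=; congr (_ + _ + _); apply: eq_bigr => i _.
Qed.

Lemma treeB_shift n c q s h z a e f :
  treeB n c q s (a + h) (e + z) f =
  treeB n c q s h z (fun h z => f (a + h) (e + z)).
Proof.
elim: n c q s h z => [|n IH] c q s h z //=.
by rewrite -addnS IH; congr (_ + _ + _); apply: eq_bigr => i _; rewrite -?addnA IH.
Qed.

(* A run of high entries is compared with the same run started one level lower;
   the two can only differ at the first step going down to level c. *)
Lemma treeB_high_run n c s k h z f : all (geq c) s ->
  treeB n c.+1 1 (s ++ nseq k c.+1) h z f =
  treeB n c 1 (s ++ nseq k c) h z f +
  \sum_(j < n) treeB (n - j.+1) c 2 (rcons s c) (h + j) z f.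
Proof.
move=> sc; elim: n k h => [|n IH] k h.
  by rewrite big_ord0 addn0 /= !size_cat !size_nseq.
have rn x : rcons (s ++ nseq k x) x = s ++ nseq k.+1 x.
  by rewrite -cats1 -catA; congr (_ ++ _); rewrite cats1; elim: (k) => //= j ->.
have fs i x : i < x -> [seq y <- s ++ nseq k x | y <= i] = [seq y <- s | y <= i].
  move=> ix; rewrite filter_cat; have -> : [seq y <- nseq k x | y <= i] = [::].
    by elim: (k) => //= j ->; rewrite leqNgt ix.
  by rewrite cats0.
have down x : c <= x ->
    \sum_(i < c) treeB n i 2 (rcons [seq y <- s ++ nseq k x | y <= i] i) h z f =
    \sum_(i < c) treeB n i 2 (rcons [seq y <- s | y <= i] i) h z f.
  by move=> cx; apply: eq_bigr => i _; rewrite fs // (leq_trans (ltn_ord i)).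
rewrite /= !big_ord1 !addn0 subn0 !rn IH big_ord_recr /= fs //.
rewrite !down // (all_filterP _) // [in RHS]big_ord_recl /= addn0 subn1 addn1 /=.
under [X in _ = _ + (_ + X)]eq_bigr => i _ do rewrite /bump add1n subSS addnS -addSn.
by lia.
Qed.

(** * Lowering the words that avoid 011 and 201 *)

Lemma antidiagonal_sum n (G : nat -> nat -> nat) :
  \sum_(k < n.+1) \sum_(i < (n - k).+1) G k i =
  \sum_(i < n.+1) \sum_(k < (n - i).+1) G k i.
Proof.
have widen (H : nat -> nat) (k : 'I_n.+1) :
    \sum_(i < (n - k).+1) H i = \sum_(i < n.+1 | k + i <= n) H i.
  rewrite (big_ord_widen n.+1) ?ltnS ?leq_subr //; apply: eq_bigl => i.
  by have := ltn_ord k; lia.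
under eq_bigr do rewrite widen.
under [RHS]eq_bigr do rewrite (widen (fun k => G k _)).
rewrite (exchange_big_dep xpredT) //=.
by apply: eq_bigr => i _; apply: eq_bigl => k; rewrite addnC.
Qed.

(* [d] high entries are inserted in a lowered word with [h] of them, the last
   [h - i] of which stay high in the sum; [a] high entries come before. *)
Definition elevate d a (f : weight) : weight := fun h z r b =>
  slots h d * f (a + d) z r b.+1 + \sum_(i < h) slots i d * f (a + d + (h - i)) z r b.

(** Either the first high entry of the lowered word stays high, and with it all the others, so that
    nothing can be inserted; or it comes from a run of [i] high entries, which then count as coming
    before. *)
Lemma elevateS d a f h z r b :
  elevate d a f h.+1 z r b =
  (d == 0) * f (a + h.+1) z r b + \sum_(i < d.+1) elevate (d - i) (a + i) f h z r b.
Proof.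
rewrite /elevate big_split /= big_ord_recl slots0 subn0 addnCA; congr (_ + _).
  by case: d => [|d]; rewrite ?addn0 // !mul0n.
rewrite exchange_big slotsS big_distrl /=; congr (_ + _); last first.
  apply: eq_bigr => i _; rewrite slotsS big_distrl /=; apply: eq_bigr => j _.
  by congr (_ * f _ _ _ _); have := ltn_ord j; rewrite /bump /=; lia.
by apply: eq_bigr => j _; congr (_ * f _ _ _ _); have := ltn_ord j; lia.
Qed.

Lemma all_geqW c d s : c <= d -> all (geq c) s -> all (geq d) s.
Proof. by move=> cd; apply: sub_all => x /= xc; apply: leq_trans cd. Qed.

(** Here [k] letters form the lowered word and [n - k] high entries are inserted. Induction on [n]
    by the first letter: children match one by one, except that the high letter and the new maximum
    just below it both lower to a high letter. *)
Lemma treeB_elevate n c q s h z f : 0 < q -> all (geq c) s ->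
  treeB n c q.+1 s h z f =
  \sum_(k < n.+1) treeB k c q s 0 z (elevate (n - k) h f).
Proof.
elim/ltn_ind: n c q s h z => -[_|n IH] c q s h z q0 sc.
  by rewrite big_ord1 /= /elevate slots0 big_ord0 !addn0 mul1n; case: q q0.
(* For [k = 0] the lowered word has no letter left for a run to precede, so nothing is
   contributed. *)
rewrite big_ord_recl /= {1}/elevate slots0 big_ord0 mul0n !add0n.
rewrite !big_split /=; congr (_ + _ + _); last by rewrite IH.
  case: q q0 => // q _.
  rewrite exchange_big big_ord_recr big_ord_recr [RHS]big_ord_recr /=.
  rewrite -addnA; congr (_ + _).
    apply: eq_bigr => i _; have iq := ltn_ord i.
    have [-> ->] : (i.+1 == q.+2) = false /\ (i.+1 == q.+1) = false by lia.
    rewrite addn0 subSn ?IH ?subn_gt0 ?all_rcons; try lia.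
    - by apply: eq_bigr => k _; rewrite subSS addn0.
    - by rewrite /= leqnn (all_geqW (leq_addr _ _) sc).
  set c' := c + q; set s' := rcons s c'.
  have sc' : all (geq c') s by exact: all_geqW (leq_addr _ _) sc.
  have sc'' : all (geq c') s' by rewrite all_rcons /= leqnn.
  have -> : q.+2 - q = 2 by lia.
  have -> : q.+2 - q.+1 = 1 by lia.
  have -> : q.+1 - q = 1 by lia.
  have -> : rcons s (c + q.+1) = s ++ nseq 1 c'.+1 by rewrite cats1 addnS.
  rewrite !eqxx ltn_eqF // addn0 add0n [c + q.+1]addnS treeB_high_run // cats1 -/s'.
  (* In the lowered word this child begins with a high entry, and [elevateS] splits off that
     entry. *)
  have peel_high k : treeB k c' 1 s' 1 z (elevate (n - k) h f) =
     (n - k == 0) * treeB k c' 1 s' (h + 1) z f +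
     \sum_(i < (n - k).+1) treeB k c' 1 s' 0 z (elevate (n - k - i) (h + i) f).
    rewrite (treeB_shift k c' 1 s' 0 z 1 0).
    rewrite (@treeB_ext _ _ _ _ _ _ _ (fun x y r b => (n - k == 0) * f (h + x.+1) y r b +
      \sum_(i < (n - k).+1) elevate (n - k - i) (h + i) f x y r b)) //; last first.
      by move=> *; exact: elevateS.
    rewrite treeB_add; congr (_ + _).
      rewrite (treeB_scale _ _ _ _ _ _ _ (fun x y => f (h + x.+1) y)).
      have -> : h + 1 = h.+1 + 0 by rewrite addn0 addn1.
      rewrite -[z in RHS]add0n treeB_shift.
      by congr (_ * _); apply: treeB_ext => // *; rewrite addnS.
    exact: (treeB_sum _ _ _ _ _ _ _ (fun i => elevate (n - k - i) (h + i) f)).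
  under [RHS]eq_bigr => k _ do rewrite add0n /bump add1n subSS peel_high.
  rewrite big_split /=.
  have -> : \sum_(k < n.+1) (n - k == 0) * treeB k c' 1 s' (h + 1) z f =
            treeB n c' 1 s' (h + 1) z f.
    rewrite big_ord_recr /= subnn eqxx mul1n big1 // => k _.
    by have -> : (n - k == 0) = false by have := ltn_ord k; lia.
  rewrite addnCA; congr (_ + _).
  rewrite (antidiagonal_sum n (fun k i => treeB k c' 1 s' 0 z (elevate (n - k - i) (h + i) f))).
  (* [i] is the length of the run in front of the lowered letter: [i = 0] is the new maximum of
     bounce 2, and [i > 0] are the drops produced by [treeB_high_run]. *)
  rewrite [RHS]big_ord_recl /= addn0 subn0.
  congr (_ + _).
    by rewrite IH //; apply: eq_bigr => k _; rewrite subn0.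
  apply: eq_bigr => j _; rewrite IH // ?ltnS ?leq_subr // /bump add1n.
  by rewrite addn1 addSnnS; apply: eq_bigr => k _; rewrite subnAC.
rewrite exchange_big /=; apply: eq_bigr => i _; rewrite IH //.
by rewrite all_rcons /= leqnn; apply/allP => x; rewrite mem_filter => /andP[].
Qed.

(** The [j] high entries of the initial run act as one more run, so [slots i] becomes [slots i.+1],
    which is the binomial of [peel] at height [m = h - i]. *)
Lemma sum_elevate d g h z r b :
  \sum_(j < d.+1) elevate (d - j) j g h z.+1 r b = peel d g h z r b.
Proof.
rewrite /elevate /peel big_split /= [RHS]big_ord_recl subn0 add0n /=.
congr (_ + _).
  rewrite addn1 (_ : 'C(h + d, d) = slots h.+1 d) // slotsS big_distrl.
  by apply: eq_bigr => j _; rewrite subnKC // -ltnS.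
rewrite exchange_big (reindex_inj rev_ord_inj) /=; apply: eq_bigr => i _.
have ih := ltn_ord i.
rewrite (_ : 'C(_, d) = slots (h - i.+1).+1 d); last by rewrite /bump add1n.
rewrite slotsS big_distrl; apply: eq_bigr => j _.
by congr (_ * g _ _ _ _); have := ltn_ord j; rewrite /bump /=; lia.
Qed.

(** From this state only a high entry or a zero can be appended, so [j] high entries precede the
    next zero, unless all [n] letters are high. *)
Lemma treeB_first n k h z g :
  treeB n 0 1 (nseq k.+1 0) h z g =
  g (h + n) z (k + n) 0 + \sum_(j < n) treeB (n - j.+1) 0 2 [:: 0] (h + j) z.+1 g.
Proof.
elim: n k h => [|n IH] k h; first by rewrite big_ord0 !addn0 /= size_nseq.
have rn : rcons (nseq k 0) 0 = nseq k.+1 0 by elim: (k) => //= j ->.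
rewrite /= big_ord1 big_ord0 !addn0 subn0 rn (IH k.+1).
rewrite [in RHS]big_ord_recl /= addn0 subn1 addn1 !addnS !addSn.
under [X in _ = _ + (_ + X)]eq_bigr => i _ do rewrite /bump add1n addnS -addSn.
under [X in _ = _ + (_ + X)]eq_bigr => i _ do rewrite subSS.
by rewrite -addnA [X in _ + X]addnC.
Qed.

Definition sumB n g := treeB n 0 1 [:: 0] 0 0 g.

Lemma peel_rec_sumB : peel_rec sumB.
Proof.
move=> n g; rewrite /sumB (treeB_first n 0) !add0n; congr (_ + _).
case: n => [|n]; first by rewrite !big_ord0.
under eq_bigr => j _ do rewrite treeB_elevate // subSS add0n.
rewrite -(antidiagonal_sum n (fun k j => treeB k 0 1 [:: 0] 0 1 (elevate (n - j - k) j g))).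
apply: eq_bigr => k _; rewrite -(treeB_sum _ _ _ _ _ _ _ (fun j => elevate (n - j - k) j g)).
(* The second zero serves as first zero of the lowered word, which therefore has one zero less. *)
rewrite (treeB_shift k 0 1 [:: 0] 0 0 0 1); apply: treeB_ext => // h z r b.
rewrite subSS -sum_elevate; apply: eq_bigr => j _.
by rewrite subnAC.
Qed.

(** * The generating tree of the classes C *)

Definition stateC := nat -> nat -> nat -> nat -> nat -> nat.

(** Since 010 is avoided, the letter is a zero exactly while the maximum is 0, that is, while [b] is
    0. *)
Definition nonmax (F : stateC) : stateC := fun c q a b d =>
  \sum_(i < c.+1) F i q.+1 (a + (b == 0)) b d.

Definition newmax (F : stateC) : stateC := fun c q a b d =>
  \sum_(i < q) F i (q - i) a b.+1 (d + (i.+1 == q)).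

Definition treeC n (F : stateC) : stateC :=
  iter n (fun F c q a b d => nonmax F c q a b d + newmax F c q a b d) F.

Lemma treeC_ext n F G c q a b d : 0 < q ->
  (forall c q a b d, 0 < q -> F c q a b d = G c q a b d) ->
  treeC n F c q a b d = treeC n G c q a b d.
Proof.
move=> + FG; elim: n c q a b d => [|n IH] c q a b d q0 /=; first exact: FG.
by congr (_ + _); apply: eq_bigr => i _; apply: IH; rewrite ?subn_gt0.
Qed.

Lemma treeCS n F c q a b d :
  treeC n.+1 F c q a b d = nonmax (treeC n F) c q a b d + newmax (treeC n F) c q a b d.
Proof. by []. Qed.

(** Classification by the last left-to-right maximum appended, if any: [k] letters precede it and
    [n - k.+1] letters not exceeding it follow. *)
Lemma treeC_last n F c q a b d :
  treeC n F c q a b d = iter n nonmax F c q a b d +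
  \sum_(k < n) treeC k (newmax (iter (n - k.+1) nonmax F)) c q a b d.
Proof.
elim: n c q a b d => [|n IH] c q a b d; first by rewrite big_ord0 addn0.
rewrite big_ord_recl subn1 treeCS.
under [in RHS]eq_bigr => k _ do rewrite lift0 subSS treeCS.
have -> : nonmax (treeC n F) c q a b d = iter n.+1 nonmax F c q a b d +
    \sum_(k < n) nonmax (treeC k (newmax (iter (n - k.+1) nonmax F))) c q a b d.
  by rewrite exchange_big -big_split; apply: eq_bigr => i _; rewrite IH.
have -> : newmax (treeC n F) c q a b d = newmax (iter n nonmax F) c q a b d +
    \sum_(k < n) newmax (treeC k (newmax (iter (n - k.+1) nonmax F))) c q a b d.
  by rewrite exchange_big -big_split; apply: eq_bigr => i _; rewrite IH.
by rewrite big_split /=; lia.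
Qed.

Definition leaf (g : weight) : stateC := fun c q a b d => g q.-1 b a d.

Lemma iter_nonmax n g c q a b d :
  iter n nonmax (leaf g) c q a b.+1 d = slots c.+1 n * g (q + n).-1 b.+1 a d.
Proof.
elim: n c q => [|n IH] c q; first by rewrite /slots bin0 mul1n addn0.
rewrite /= /nonmax addn0; under eq_bigr do rewrite IH.
by rewrite -big_distrl sum_slots addSnnS.
Qed.

Lemma iter_nonmax0 n g q a d :
  iter n nonmax (leaf g) 0 q a 0 d = g (q + n).-1 0 (a + n) d.
Proof.
elim: n q a => [|n IH] q a; first by rewrite !addn0.
by rewrite /= /nonmax big_ord1 IH eqxx addn1 !addSnnS.
Qed.

Definition sumC n g := treeC n (leaf g) 0 1 0 0 0.

Lemma peel_rec_sumC : peel_rec sumC.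
Proof.
move=> n g; rewrite /sumC treeC_last iter_nonmax0; congr (_ + _).
apply: eq_bigr => k _; apply: treeC_ext => // c q a b d q0.
rewrite /newmax /leaf /peel; case: q q0 => // q _.
(* [m], one less than the bounce right after the new maximum, is the height of the valley. *)
rewrite (reindex_inj rev_ord_inj) /=; apply: eq_bigr => m _.
have mq := ltn_ord m.
rewrite iter_nonmax subSS -subSn // ?subSn // /slots.
  by congr (_ * g _ _ _ _); lia.
exact: leq_subr.
Qed.

(** * Inversion sequences as lists *)

Definition order_iso (p f : seq nat) : bool :=
  all (fun a => all (fun b =>
    ((nth 0 p a < nth 0 p b) == (nth 0 f a < nth 0 f b)) &&
    ((nth 0 p a == nth 0 p b) == (nth 0 f a == nth 0 f b)))
  (iota 0 (size f))) (iota 0 (size f)).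

Definition forbidden (T : seq (seq nat)) x y z : bool := has (order_iso [:: x; y; z]) T.

Definition entries n (e : {ffun 'I_n -> 'I_n}) : seq nat := [seq val (e i) | i <- enum 'I_n].

Lemma size_entries n (e : {ffun 'I_n -> 'I_n}) : size (entries e) = n.
Proof. by rewrite size_map size_enum_ord. Qed.

Lemma nth_entries n (e : {ffun 'I_n -> 'I_n}) (i : 'I_n) : nth 0 (entries e) i = e i.
Proof. by rewrite (nth_map i) ?size_enum_ord // nth_ord_enum. Qed.

Lemma containsP n (e : {ffun 'I_n -> 'I_n}) f : size f = 3 ->
  reflect (exists i j k : 'I_n,
             [/\ i < j, j < k & order_iso [:: val (e i); val (e j); val (e k)] f])
          (contains e f).
Proof.
move=> f3; rewrite /contains /order_iso f3; apply: (iffP existsP).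
  case=> s /andP[/forallP inc /forallP iso].
  pose a0 : 'I_3 := ord0; pose a1 : 'I_3 := Ordinal (isT : 1 < 3).
  pose a2 : 'I_3 := Ordinal (isT : 2 < 3).
  exists (s a0), (s a1), (s a2); split.
  - by have /forallP/(_ a1)/implyP := inc a0; apply.
  - by have /forallP/(_ a2)/implyP := inc a1; apply.
  apply/allP => a; rewrite mem_iota => /andP[_ a3].
  apply/allP => b; rewrite mem_iota => /andP[_ b3].
  have /forallP/(_ (Ordinal b3)) := iso (Ordinal a3).
  have E (c : 'I_3) : nth 0 [:: val (e (s a0)); val (e (s a1)); val (e (s a2))] c = e (s c).
    by case: c => -[|[|[|//]]] c3 /=; congr (val (e (s _))); apply: val_inj.
  by rewrite -val_eqE /= -(E (Ordinal a3)) -(E (Ordinal b3)).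
case=> i [j [k [ij jk iso]]].
pose s := [ffun a : 'I_3 => nth i [:: i; j; k] a].
exists s; apply/andP; split; apply/forallP => a; apply/forallP => b.
  apply/implyP; rewrite !ffunE; case: a b => -[|[|[|//]]] a3 [[|[|[|//]]] b3] //= _.
  exact: ltn_trans jk.
have /allP/(_ (val a)) := iso; rewrite mem_iota (ltn_ord a) => /(_ isT)/allP/(_ (val b)).
rewrite mem_iota (ltn_ord b) => /(_ isT).
by rewrite -val_eqE !ffunE; case: a b => -[|[|[|//]]] a3 [[|[|[|//]]] b3].
Qed.

Definition good_seq T (w : seq nat) : Prop :=
  (forall j, j < size w -> nth 0 w j <= j) /\
  (forall i j k, i < j -> j < k -> k < size w ->
     ~~ forbidden T (nth 0 w i) (nth 0 w j) (nth 0 w k)).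

Definition appendable T (w : seq nat) v : bool :=
  pairwise (fun x y => ~~ forbidden T x y v) w.

Lemma good_seq_rcons T w v :
  good_seq T (rcons w v) <-> [/\ good_seq T w, v <= size w & appendable T w v].
Proof.
split.
  case=> bnd av; split.
  - split=> [j jw|i j k ij jk kw].
      by have := bnd j; rewrite size_rcons nth_rcons jw => -> //; exact: ltnW.
    have := av i j k ij jk; rewrite size_rcons !nth_rcons kw.
    rewrite (ltn_trans jk kw) (ltn_trans ij (ltn_trans jk kw)); apply; exact: ltnW.
  - by have := bnd (size w); rewrite size_rcons nth_rcons ltnn eqxx => ->.
  - apply/(pairwiseP 0) => i j; rewrite !inE => iw jw ij.
    by have := av i j (size w) ij jw; rewrite size_rcons !nth_rcons ltnn eqxx iw jw; apply.
case=> -[bnd av] vw /(pairwiseP 0) ok; split=> [j|i j k ij jk].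
  rewrite size_rcons ltnS nth_rcons; case: ltngtP => // [jw _|->]; [exact: bnd|by []].
rewrite size_rcons ltnS !nth_rcons => kw.
have jw := leq_trans jk kw; rewrite jw (ltn_trans ij jw).
case: ltngtP kw => // [kw _|kw _]; first exact: av.
by apply: ok; rewrite ?inE // (ltn_trans ij).
Qed.

Fixpoint good_seqs T n : seq (seq nat) :=
  if n is n'.+1 then
    [seq rcons w v | w <- good_seqs T n', v <- [seq v <- iota 0 n | appendable T w v]]
  else [:: [::]].

Lemma good_seqsS T n : good_seqs T n.+1 =
  [seq rcons w v | w <- good_seqs T n, v <- [seq v <- iota 0 n.+1 | appendable T w v]].
Proof. by []. Qed.

Lemma mem_good_seqs T n w : w \in good_seqs T n <-> size w = n /\ good_seq T w.
Proof.
elim: n w => [|n IH] w.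
  rewrite inE; split; first by move/eqP->.
  by case=> /size0nil->.
rewrite good_seqsS; split.
  case/allpairsPdep => u [v [/IH[su gu]]]; rewrite mem_filter mem_iota ltnS => /andP[ok vn] ->.
  by rewrite size_rcons su good_seq_rcons su.
case: (lastP w) => [[]//|u v]; rewrite size_rcons => -[[su]] /good_seq_rcons[gu vu ok].
apply/allpairsPdep; exists u, v; split=> //; first exact/IH.
by rewrite mem_filter ok mem_iota -su.
Qed.

Lemma uniq_good_seqs T n : uniq (good_seqs T n).
Proof.
elim: n => // n IH; rewrite good_seqsS; apply: allpairs_uniq_dep => //.
  by move=> w _; rewrite filter_uniq ?iota_uniq.
by move=> [w v] [w' v'] _ _ /= /rcons_inj[-> ->].
Qed.

Lemma inv_avoiding_good T n (e : {ffun 'I_n -> 'I_n}) : all (fun f => size f == 3) T ->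
  e \in inv_avoiding n T <-> entries e \in good_seqs T n.
Proof.
move=> T3; rewrite mem_good_seqs size_entries inE; split.
  case/andP=> /forallP bnd /allP av; split=> //; split=> [j|i j k ij jk].
    by rewrite size_entries => jn; rewrite (nth_entries e (Ordinal jn)); exact: bnd.
  rewrite size_entries => kn; have jn := ltn_trans jk kn; have in' := ltn_trans ij jn.
  rewrite (nth_entries e (Ordinal kn)) (nth_entries e (Ordinal jn)) (nth_entries e (Ordinal in')).
  apply/hasPn => f fT; have := av f fT; apply: contra => iso.
  apply/containsP; first by apply/eqP/(allP T3).
  by exists (Ordinal in'), (Ordinal jn), (Ordinal kn).
case=> _ [bnd av]; apply/andP; split.
  by apply/forallP => j; rewrite -nth_entries bnd ?size_entries.
apply/allP => f fT; apply/negP => /containsP[|i [j [k [ij jk iso]]]].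
  by apply/eqP/(allP T3).
have := av i j k ij jk; rewrite size_entries !nth_entries => /(_ (ltn_ord k))/hasPn/(_ f fT).
by rewrite iso.
Qed.

Lemma sum_inv_avoiding T n (F : seq nat -> nat) : all (fun f => size f == 3) T ->
  \sum_(e in inv_avoiding n T) F (entries e) = \sum_(w <- good_seqs T n) F w.
Proof.
move=> T3; rewrite -big_enum -(big_map (@entries n) xpredT F).
apply: perm_big; apply: uniq_perm.
- rewrite map_inj_uniq ?enum_uniq // => e e' ee'; apply/ffunP => i.
  by apply: val_inj; rewrite /= -!nth_entries ee'.
- exact: uniq_good_seqs.
move=> w; apply/mapP/idP.
  by case=> e; rewrite mem_enum => /(inv_avoiding_good _ T3) + ->.
move=> wT; have /mem_good_seqs[wn [bnd _]] := wT.
have lt_w (i : 'I_n) : nth 0 w i < n by apply: leq_ltn_trans (ltn_ord i); apply: bnd; rewrite wn.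
pose e := [ffun i => Ordinal (lt_w i)].
have we : w = entries e.
  apply: (@eq_from_nth _ 0) => [|i]; first by rewrite size_entries.
  rewrite wn => ilt.
  by rewrite (nth_entries e (Ordinal ilt)) ffunE.
by exists e => //; rewrite mem_enum inv_avoiding_good // -we.
Qed.

Fixpoint sum_ext T n (w : seq nat) (F : seq nat -> nat) : nat :=
  if n is n'.+1 then
    \sum_(v <- iota 0 (size w).+1 | appendable T w v) sum_ext T n' (rcons w v) F
  else F w.

Lemma sum_good_seqs T m n F :
  \sum_(w <- good_seqs T (m + n)) F w = \sum_(w <- good_seqs T m) sum_ext T n w F.
Proof.
elim: n m => [|n IH] m; first by rewrite addn0.
rewrite addnS -addSn IH good_seqsS big_allpairs_dep; apply: eq_big_seq => w.
by move=> /mem_good_seqs[wm _]; rewrite big_filter -wm.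
Qed.

Lemma good_seqs1 T : good_seqs T 1 = [:: [:: 0]].
Proof. by []. Qed.

(** * Statistics of lists and their change when a letter is appended *)

Definition max_entry (w : seq nat) := \max_(x <- w) x.

Definition zero_count (w : seq nat) := count_mem 0 w.

Definition high_count (w : seq nat) := count (fun j => nth 0 w j == j) (iota 0 (size w)).

Definition lr_count (w : seq nat) :=
  count (fun j => all (fun x => x < nth 0 w j) (take j w)) (iota 0 (size w)).

(** The values are kept, not just their number, because appending a letter destroys the
    right-to-left minima that are not smaller. *)
Definition rl_list (w : seq nat) :=
  [seq nth 0 w j | j <- iota 0 (size w) & all (fun x => nth 0 w j < x) (drop j.+1 w)].

Lemma iota0S n : iota 0 n.+1 = iota 0 n ++ [:: n].
Proof. by rewrite -addn1 iotaD. Qed.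

Lemma card_ord_count n (P : pred nat) : #|[set j : 'I_n | P j]| = count P (iota 0 n).
Proof. by rewrite -sum1_count cardsE -sum1_card -[n in iota 0 n]subn0 big_mkord. Qed.

Lemma zerosE n (e : {ffun 'I_n -> 'I_n}) : zeros e = zero_count (entries e).
Proof.
rewrite /zeros /zero_count -[in RHS](mkseq_nth 0 (entries e)) count_map size_entries.
rewrite -card_ord_count; apply: eq_card => j.
by rewrite !inE /= nth_entries.
Qed.

Lemma high_entriesE n (e : {ffun 'I_n -> 'I_n}) : high_entries e = high_count (entries e).
Proof.
rewrite /high_count size_entries -card_ord_count; apply: eq_card => j.
by rewrite !inE /= nth_entries.
Qed.

Lemma bounceE n (e : {ffun 'I_n -> 'I_n}) :
  bounce e = size (entries e) - max_entry (entries e).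
Proof. by rewrite size_entries /max_entry big_map big_enum. Qed.

Lemma lr_maximaE n (e : {ffun 'I_n -> 'I_n}) : lr_maxima e = lr_count (entries e).
Proof.
rewrite /lr_count size_entries -card_ord_count; apply: eq_card => j.
rewrite !inE /=; apply/forallP/(all_nthP 0) => [lt_e i|lt_e i].
  rewrite size_take size_entries ltn_ord => ij.
  have in' := ltn_trans ij (ltn_ord j).
  rewrite nth_take // nth_entries (nth_entries e (Ordinal in')).
  by have /implyP := lt_e (Ordinal in'); apply.
apply/implyP => ij; have := lt_e i.
by rewrite size_take size_entries ltn_ord nth_take // !nth_entries; apply.
Qed.

Lemma rl_minimaE n (e : {ffun 'I_n -> 'I_n}) : rl_minima e = size (rl_list (entries e)).
Proof.
rewrite /rl_list size_map size_filter size_entries -card_ord_count; apply: eq_card => j.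
rewrite !inE /=; apply/forallP/(all_nthP 0) => [lt_e i|lt_e i].
  rewrite size_drop size_entries => ij; have in' : j.+1 + i < n by lia.
  rewrite nth_drop nth_entries (nth_entries e (Ordinal in')).
  by have /implyP := lt_e (Ordinal in'); apply; rewrite /= addSn ltnS leq_addr.
apply/implyP => ij; have := lt_e (i - j.+1).
rewrite size_drop size_entries nth_drop subnKC // !nth_entries; apply.
by have := ltn_ord i; lia.
Qed.

Lemma max_entry_rcons w v : max_entry (rcons w v) = maxn (max_entry w) v.
Proof. by rewrite /max_entry big_rcons /= maxnC. Qed.

Lemma leq_max_entry w x : x \in w -> x <= max_entry w.
Proof. by move=> xw; exact: (@leq_bigmax_seq _ _ xpredT id). Qed.

Lemma mem_max_entry w : 0 < size w -> max_entry w \in w.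
Proof.
elim: w => //= x w IH _; rewrite /max_entry big_cons -/(max_entry w) inE.
case: (posnP (size w)) => [/size0nil-> | /IH mw].
  by rewrite /max_entry big_nil maxn0 eqxx.
by case: leqP; rewrite ?mw ?orbT ?eqxx.
Qed.

Lemma zero_count_rcons w v : zero_count (rcons w v) = zero_count w + (v == 0).
Proof. by rewrite /zero_count -cats1 count_cat /= addn0. Qed.

Lemma high_count_rcons w v : high_count (rcons w v) = high_count w + (v == size w).
Proof.
rewrite /high_count size_rcons iota0S count_cat /= addn0 nth_rcons ltnn eqxx.
by congr (_ + _); apply: eq_in_count => j; rewrite mem_iota nth_rcons => /= ->.
Qed.

Lemma lr_count_rcons w v : 0 < size w ->
  lr_count (rcons w v) = lr_count w + (max_entry w < v).
Proof.
move=> w0; rewrite /lr_count size_rcons iota0S count_cat /= addn0.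
rewrite nth_rcons ltnn eqxx -[in take (size w) _]cats1 take_size_cat //.
congr (_ + _).
  apply: eq_in_count => j; rewrite mem_iota nth_rcons -cats1 => /= jw.
  by rewrite jw takel_cat // ltnW.
congr nat_of_bool; apply/allP/idP => [/(_ _ (mem_max_entry w0)) //|vw x /leq_max_entry].
by move/leq_ltn_trans; apply.
Qed.

Lemma rl_list_rcons w v :
  rl_list (rcons w v) = rcons [seq x <- rl_list w | x < v] v.
Proof.
rewrite /rl_list size_rcons iota0S filter_cat map_cat /= nth_rcons ltnn eqxx.
rewrite drop_oversize ?size_rcons //= nth_rcons ltnn eqxx -[RHS]cats1; congr (_ ++ _).
rewrite filter_map -filter_predI.
rewrite (@eq_in_filter _ _ (predI (preim (nth 0 w) (fun x => x < v))
   (fun j => all (fun x => nth 0 w j < x) (drop j.+1 w)))); last first.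
  move=> j; rewrite mem_iota nth_rcons => /= jw.
  by rewrite jw drop_rcons // all_rcons.
by apply/eq_in_map => j; rewrite mem_filter mem_iota nth_rcons => /and3P[_ _ /= ->].
Qed.

Definition statsC w q a b d : Prop :=
  [/\ 0 < q, max_entry w + q = size w, zero_count w = a.+1, lr_count w = b.+1 & high_count w = d.+1].

Lemma statsC_nonmax w q a b d v : statsC w q a b d -> v <= max_entry w ->
  statsC (rcons w v) q.+1 (a + (v == 0)) b d.
Proof.
move=> [q0 mq wa wb wd] vm; have w0 : 0 < size w by lia.
rewrite /statsC size_rcons max_entry_rcons zero_count_rcons
  high_count_rcons lr_count_rcons //.
rewrite wa wb wd; split=> //; lia.
Qed.

Lemma statsC_newmax w q a b d i : statsC w q a b d -> i < q ->
  statsC (rcons w ((max_entry w).+1 + i)) (q - i) a b.+1 (d + (i.+1 == q)).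
Proof.
move=> [q0 mq wa wb wd] iq; have w0 : 0 < size w by lia.
rewrite /statsC size_rcons max_entry_rcons zero_count_rcons
  high_count_rcons lr_count_rcons //.
rewrite wa wb wd; split=> //; lia.
Qed.

Lemma sum_iota m n (G : nat -> nat) : \sum_(v <- iota m n) G v = \sum_(i < n) G (m + i).
Proof. by rewrite -[m in LHS]addn0 iotaDl big_map -[n in iota 0 n]subn0 big_mkord. Qed.

(* The appendable letters up to the current maximum form an interval [s, s + c];
   [p] matches the letter [s + p i] with the child of index [i]. *)
Definition ruleC T (K : seq nat -> nat -> Prop) : Prop := forall w c, 0 < size w -> K w c ->
  exists s (p : 'I_c.+1 -> 'I_c.+1), [/\ injective p, s + c <= max_entry w,
    (s == 0) = (max_entry w == 0),
    (forall v, appendable T w v = (s <= v <= s + c) || (max_entry w < v)) &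
    (forall i, K (rcons w (s + p i)) i) /\
    (forall i, K (rcons w ((max_entry w).+1 + i)) i)].

Lemma sum_ext_treeC T K f n w c q a b d : ruleC T K -> K w c -> statsC w q a b d ->
  (b == 0) = (max_entry w == 0) ->
  sum_ext T n w (fun w =>
    f (size w - max_entry w) (lr_count w) (zero_count w) (high_count w)) =
  treeC n (leaf (succ_weight f)) c q a b d.
Proof.
move=> rule; elim: n w c q a b d => [|n IH] w c q a b d Kw st bm.
  by case: st => q0 mq wa wb wd; rewrite /= wa wb wd -mq addKn /leaf /succ_weight prednK.
have [q0 mq _ _ _] := st; have w0 : 0 < size w by lia.
have [s [p [p_inj sc s0 app [K1 K2]]]] := rule _ _ w0 Kw.
rewrite treeCS.
pose G v := sum_ext T n (rcons w v)
  (fun w => f (size w - max_entry w) (lr_count w) (zero_count w) (high_count w)).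
have split_app : \sum_(v <- iota 0 (size w).+1 | appendable T w v) G v =
   \sum_(i < c.+1) G (s + i) + \sum_(i < q) G ((max_entry w).+1 + i).
  rewrite -!sum_iota -big_filter -big_cat; apply: perm_big; apply: uniq_perm.
  - by rewrite filter_uniq ?iota_uniq.
  - have disj x : x \in iota (max_entry w).+1 q -> x \notin iota s c.+1.
      by rewrite !mem_iota; clear -sc; lia.
    by rewrite cat_uniq !iota_uniq andbT; apply/hasPn => x /disj.
  move=> x; rewrite mem_filter mem_cat !mem_iota app; clear -sc mq; lia.
rewrite [LHS]split_app; congr (_ + _).
  rewrite (reindex_inj p_inj) /=; apply: eq_bigr => i _.
  have pi := ltn_ord (p i).
  rewrite bm -s0.
  (* If [s] is 0 then so is the maximum; hence [c] is 0 and the only letter of the interval is 0. *)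
  have -> : a + (s == 0) = a + (s + p i == 0).
    by lia.
  apply: IH; [exact: K1 | apply: statsC_nonmax => // |].
    lia.
  rewrite max_entry_rcons bm; lia.
apply: eq_bigr => i _; apply: IH; [exact: K2 | exact: statsC_newmax | ].
rewrite max_entry_rcons; lia.
Qed.

Lemma appendable_rcons T w v u : appendable T (rcons w v) u =
  appendable T w u && all (fun x => ~~ forbidden T x v u) w.
Proof. by rewrite /appendable pairwise_rcons andbC. Qed.

Ltac order_cases x y z :=
  rewrite /forbidden /order_iso /= !ltnn !eqxx /=;
  case: (ltngtP x y) => xy; case: (ltngtP y z) => yz; case: (ltngtP x z) => xz //=; exfalso; lia.

Lemma forbidden_010_101_120_201 x y z : forbidden T_010_101_120_201 x y z =
  [|| (x == z) && (x < y), (x == z) && (y < x), (z < x) && (x < y) | (y < z) && (z < x)].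
Proof. by order_cases x y z. Qed.

Lemma forbidden_010_110_120_210 x y z : forbidden T_010_110_120_210 x y z =
  (z < y) && ((z <= x) || (x == y)).
Proof. by order_cases x y z. Qed.

Lemma forbidden_010_100_120_210 x y z : forbidden T_010_100_120_210 x y z =
  [|| (x == z) && (x < y), (z < x) && (x < y), (z == y) && (y < x) | (z < y) && (y < x)].
Proof. by order_cases x y z. Qed.

Lemma forbidden_011_201 x y z : forbidden T_011_201 x y z =
  (x < y) && (y == z) || (y < z) && (z < x).
Proof. by order_cases x y z. Qed.

(** * Appendable letters in the classes C *)

Definition inv_010_101_120_201 (w : seq nat) c : Prop := exists s,
  [/\ s + c \in w, (s == 0) = (max_entry w == 0),
   forall x : nat, x \in w -> x < s \/ s + c <= x &
   forall v, appendable T_010_101_120_201 w v = (s <= v <= s + c) || (max_entry w < v)].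

(** After [v = s + i], the maximum, [v] and a letter above [v] up to the maximum would form 101 or
    201, so [[s, v]] remains. A new maximum excludes all letters up to the old one, by 010 and
    120. *)
Lemma ruleC_010_101_120_201 : ruleC T_010_101_120_201 inv_010_101_120_201.
Proof.
move=> w c w0 [s [lw s0 gap app]]; have mw := mem_max_entry w0; have lm := leq_max_entry lw.
exists s, id; split=> //; split=> i.
  have ic := ltn_ord i; exists s; rewrite max_entry_rcons mem_rcons inE eqxx; split=> //; first lia.
    by move=> x; rewrite mem_rcons inE => /orP[/eqP|/gap]; lia.
  move=> u; rewrite appendable_rcons app; apply/andP/idP.
    by case=> + /allP/(_ _ mw); rewrite forbidden_010_101_120_201; lia.
  move=> su; split; first lia.
  apply/allP => x xw; have := gap x xw; have := leq_max_entry xw.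
  by rewrite forbidden_010_101_120_201; lia.
exists (max_entry w).+1; rewrite max_entry_rcons mem_rcons inE eqxx; split=> //; first lia.
  by move=> x; rewrite mem_rcons inE => /orP[/eqP|/leq_max_entry]; lia.
move=> u; rewrite appendable_rcons app; apply/andP/idP.
  by case=> + /allP/(_ _ mw); rewrite forbidden_010_101_120_201; lia.
move=> su; split; first lia.
apply/allP => x xw; have := leq_max_entry xw.
by rewrite forbidden_010_101_120_201; lia.
Qed.

Definition inv_010_110_120_210 (w : seq nat) c : Prop := exists s,
  [/\ s + c = max_entry w, (s == 0) = (max_entry w == 0),
   forall x : nat, x \in w -> x <= s \/ x = max_entry w &
   forall v, appendable T_010_110_120_210 w v = (s <= v)].

Lemma ruleC_010_110_120_210 : ruleC T_010_110_120_210 inv_010_110_120_210.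
Proof.
move=> w c w0 [s [sc s0 gap app]]; have mw := mem_max_entry w0.
(* Appending [v] excludes everything below it, by 110 or 210 with the maximum in front; the interval
   from [v] to the maximum has index [i] when [v] lies [i] below the maximum. *)
exists s, (@rev_ord _); split=> //; [exact: rev_ord_inj|lia|by move=> v; rewrite app; lia|].
split=> i.
  have ic := ltn_ord i; exists (s + rev_ord i); rewrite max_entry_rcons /=; split; [lia|lia| |].
    by move=> x; rewrite mem_rcons inE => /orP[/eqP|/gap]; lia.
  move=> u; rewrite appendable_rcons app; apply/andP/idP.
    by case=> + /allP/(_ _ mw); rewrite forbidden_010_110_120_210; lia.
  move=> su; split; first lia.
  apply/allP => x xw; have := gap x xw; have := leq_max_entry xw.
  by rewrite forbidden_010_110_120_210; lia.
exists (max_entry w).+1; rewrite max_entry_rcons; split; [lia|lia| |].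
  by move=> x; rewrite mem_rcons inE => /orP[/eqP|/leq_max_entry]; lia.
move=> u; rewrite appendable_rcons app; apply/andP/idP.
  by case=> + /allP/(_ _ mw); rewrite forbidden_010_110_120_210; lia.
move=> su; split; first lia.
apply/allP => x xw; have := leq_max_entry xw.
by rewrite forbidden_010_110_120_210; lia.
Qed.

Definition inv_010_100_120_210 (w : seq nat) c : Prop := exists s,
  [/\ s + c = max_entry w, (s == 0) = (max_entry w == 0),
   forall x : nat, x \in w -> x < s \/ x = max_entry w &
   forall v, appendable T_010_100_120_210 w v = (s <= v)].

Lemma ruleC_010_100_120_210 : ruleC T_010_100_120_210 inv_010_100_120_210.
Proof.
move=> w c w0 [s [sc s0 gap app]]; have mw := mem_max_entry w0.
(* Repeating the maximum changes nothing, hence index [c]. A smaller [v] excludes itself by 100 and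
   the letters below by 210, so index [i] requires [v] to be [i.+1] below the maximum. *)
pose p (i : 'I_c.+1) : 'I_c.+1 := inord (if i == c :> nat then c else c.-1 - i).
have pE i : p i = (if i == c :> nat then c else c.-1 - i) :> nat.
  by rewrite inordK //; case: ifP; lia.
exists s, p; split=> //.
- move=> i j /(congr1 val); rewrite /= !pE => ij; apply: val_inj => /=.
  by have := ltn_ord i; have := ltn_ord j; move: ij; case: eqP; case: eqP; lia.
- lia.
- by move=> v; rewrite app; lia.
split=> i.
  have ic := ltn_ord i; rewrite pE; case: eqP => [ic'|/eqP ic'].
    exists s; rewrite max_entry_rcons; split; [lia|lia| |].
      by move=> x; rewrite mem_rcons inE => /orP[/eqP|/gap]; lia.
    move=> u; rewrite appendable_rcons app; apply/andP/idP; first by case.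
    move=> su; split=> //.
    apply/allP => x xw; have := gap x xw; have := leq_max_entry xw.
    by rewrite forbidden_010_100_120_210; lia.
  exists (s + (c.-1 - i)).+1; rewrite max_entry_rcons /=; split; [lia|lia| |].
    by move=> x; rewrite mem_rcons inE => /orP[/eqP|/gap]; lia.
  move=> u; rewrite appendable_rcons app; apply/andP/idP.
    by case=> + /allP/(_ _ mw); rewrite forbidden_010_100_120_210; lia.
  move=> su; split; first lia.
  apply/allP => x xw; have := gap x xw; have := leq_max_entry xw.
  by rewrite forbidden_010_100_120_210; lia.
exists (max_entry w).+1; rewrite max_entry_rcons; split; [lia|lia| |].
  by move=> x; rewrite mem_rcons inE => /orP[/eqP|/leq_max_entry]; lia.
move=> u; rewrite appendable_rcons app; apply/andP/idP.
  by case=> + /allP/(_ _ mw); rewrite forbidden_010_100_120_210; lia.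
move=> su; split; first lia.
apply/allP => x xw; have := leq_max_entry xw.
by rewrite forbidden_010_100_120_210; lia.
Qed.

Lemma max_entry1 : max_entry [:: 0] = 0.
Proof. by rewrite /max_entry big_seq1. Qed.

Lemma sum_inv_avoiding_C T K f n : all (fun p => size p == 3) T -> ruleC T K -> K [:: 0] 0 ->
  \sum_(e in inv_avoiding n.+1 T)
    f (bounce e) (lr_maxima e) (zeros e) (high_entries e) = sumC n (succ_weight f).
Proof.
move=> T3 rule K0.
under eq_bigr do rewrite bounceE lr_maximaE zerosE high_entriesE.
rewrite (sum_inv_avoiding _ (fun w => f (size w - max_entry w) (lr_count w)
  (zero_count w) (high_count w))) // -add1n sum_good_seqs good_seqs1 big_seq1.
apply: (sum_ext_treeC _ _ rule K0); rewrite ?max_entry1 //.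
by split; rewrite ?max_entry1.
Qed.

Lemma sum_inv_avoiding_classC T f n :
  T \in [:: T_010_101_120_201; T_010_110_120_210; T_010_100_120_210] ->
  \sum_(e in inv_avoiding n.+1 T)
    f (bounce e) (lr_maxima e) (zeros e) (high_entries e) = sumC n (succ_weight f).
Proof.
rewrite !inE => /or3P[] /eqP->.
- apply: sum_inv_avoiding_C ruleC_010_101_120_201 _ => //.
  exists 0; rewrite max_entry1; split=> // [x|v]; last by rewrite lt0n; case: v.
  by right.
- apply: sum_inv_avoiding_C ruleC_010_110_120_210 _ => //.
  by exists 0; rewrite max_entry1; split=> // x; rewrite inE => /eqP->; left.
- apply: sum_inv_avoiding_C ruleC_010_100_120_210 _ => //.
  by exists 0; rewrite max_entry1; split=> // x; rewrite inE => /eqP->; right.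
Qed.

(** * Appendable letters for 011, 201 *)

Definition count_lt (A : seq nat) u := count (fun a => a < u) A.

Lemma leq_count_lt A u v : u <= v -> count_lt A u <= count_lt A v.
Proof. by move=> uv; apply: sub_count => a /= au; apply: leq_trans uv. Qed.

Lemma ltn_count_lt A u v : u \in A -> u < v -> count_lt A u < count_lt A v.
Proof.
move=> + uv; rewrite /count_lt; elim: A => //= a A IH; rewrite inE => /orP[/eqP<-|/IH].
  by rewrite ltnn uv add0n add1n ltnS; exact/leq_count_lt/ltnW.
by case: (ltnP a u) => [au|_]; rewrite ?(ltn_trans au uv); lia.
Qed.

Lemma count_lt_nth A i : sorted ltn A -> i < size A -> count_lt A (nth 0 A i) = i.
Proof.
rewrite /count_lt; elim: A i => //= a A IH i aA.
have lt_a := order_path_min ltn_trans aA.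
case: i => [_|i iA] /=.
  rewrite ltnn add0n; apply/eqP; rewrite -leqn0 leqNgt -has_count; apply/hasPn => b.
  by move/(allP lt_a) => /=; lia.
by rewrite IH ?(path_sorted aA) // (allP lt_a) ?mem_nth.
Qed.

Lemma count_lt_filter A u v : u <= v -> count_lt [seq a <- A | a < v] u = count_lt A u.
Proof.
move=> uv; rewrite /count_lt count_filter; apply: eq_count => a /=.
by rewrite andb_idr // => /leq_trans; apply.
Qed.

Lemma mem_rl_list w x : x \in rl_list w -> x \in w.
Proof. by case/mapP => j; rewrite mem_filter mem_iota => /andP[_ jw] ->; rewrite mem_nth. Qed.

Definition statsB w q h z : Prop :=
  [/\ 0 < q, max_entry w + q = size w, high_count w = h.+1 & zero_count w = z.+1].

Lemma statsB_low w q h z v : statsB w q h z -> v <= max_entry w ->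
  statsB (rcons w v) q.+1 h (z + (v == 0)).
Proof.
move=> [q0 mq wh wz] vm; rewrite /statsB size_rcons max_entry_rcons zero_count_rcons
  high_count_rcons.
rewrite wh wz; split=> //; lia.
Qed.

Lemma statsB_newmax w q h z i : statsB w q h z -> i < q ->
  statsB (rcons w ((max_entry w).+1 + i)) (q - i) (h + (i.+1 == q)) z.
Proof.
move=> [q0 mq wh wz] iq; rewrite /statsB size_rcons max_entry_rcons zero_count_rcons
  high_count_rcons.
rewrite wh wz; split=> //; lia.
Qed.

(* [A] lists the nonzero letters below the maximum that can still be appended. *)
Definition inv_011_201 (w : seq nat) c s : Prop := exists A,
  [/\ size A = c /\ sorted ltn A, forall u : nat, u \in A -> 0 < u < max_entry w /\ u \notin w,
   0 \in w, s = [seq count_lt A u | u <- rl_list w] &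
   forall v, appendable T_011_201 w v = [|| v == 0, v \in A | max_entry w < v]].

(** The maximum, the new zero and a nonzero letter below the maximum would form 201, so [A] is
    emptied. *)
Lemma inv_011_201_zero w c s : inv_011_201 w c s -> inv_011_201 (rcons w 0) 0 [:: 0].
Proof.
case=> A [[sA srt] Aw w0 sE app].
have mw : max_entry w \in w by apply: mem_max_entry; case: (w) w0.
exists [::]; rewrite max_entry_rcons maxn0 mem_rcons inE eqxx; split=> //.
  rewrite rl_list_rcons; have -> : [seq x <- rl_list w | x < 0] = [::] by elim: (rl_list w).
  by [].
move=> u; rewrite appendable_rcons app in_nil orFb; apply/andP/idP.
  case=> /or3P[-> //|uA|->]; last by rewrite orbT.
  have [um _] := Aw u uA; move/allP/(_ _ mw); rewrite forbidden_011_201; lia.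
move=> u0; split; first by case/orP: u0 => ->; rewrite ?orbT.
apply/allP => x xw; have := leq_max_entry xw; rewrite forbidden_011_201; lia.
Qed.

(** The larger letters of [A] are lost to 201, with the maximum in front, and [v] itself to 011,
    with a zero in front. *)
Lemma inv_011_201_down A w v : sorted ltn A ->
  (forall u : nat, u \in A -> 0 < u < max_entry w /\ u \notin w) -> 0 \in w ->
  (forall v, appendable T_011_201 w v = [|| v == 0, v \in A | max_entry w < v]) ->
  v \in A ->
  inv_011_201 (rcons w v) (count_lt A v)
    (rcons [seq x <- [seq count_lt A u | u <- rl_list w] | x <= count_lt A v] (count_lt A v)).
Proof.
move=> srt Aw w0 app vA; have [/andP[v0 vm] vw] := Aw v vA.
have mw : max_entry w \in w by apply: mem_max_entry; case: (w) w0.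
have mv : maxn (max_entry w) v = max_entry w by lia.
exists [seq a <- A | a < v]; rewrite max_entry_rcons mv mem_rcons inE w0 orbT; split=> //.
- by split; [rewrite size_filter | exact: sorted_filter ltn_trans _ _ srt].
- move=> u; rewrite mem_filter => /andP[uv uA]; have [um uw] := Aw u uA.
  by rewrite mem_rcons inE negb_or uw andbT; split=> //; lia.
- rewrite rl_list_rcons map_rcons count_lt_filter // filter_map; congr rcons.
  (* Comparing counts agrees with comparing letters: [v] is in [A], so any larger letter has a
     strictly larger count, and an entry of [w] never equals [v]. *)
  rewrite (@eq_in_filter _ (preim _ _) (fun x => x < v)); last first.
    move=> u /mem_rl_list uw /=; case: (ltngtP u v) => [uv|vu|uv].
    - by rewrite leq_count_lt // ltnW.
    - by rewrite leqNgt ltn_count_lt.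
    - by rewrite -uv uw in vw.
  apply/eq_in_map => u; rewrite mem_filter => /andP[uv _].
  by rewrite count_lt_filter // ltnW.
move=> u; rewrite appendable_rcons app mem_filter; apply/andP/idP.
  case=> uA /allP fb; have := fb _ mw; have := fb _ w0; rewrite !forbidden_011_201.
  case/or3P: uA => [->//|uA|->]; rewrite ?orbT // uA andbT.
  have [um _] := Aw u uA; clear -um v0 vm; lia.
move=> uA; split; first by case/or3P: uA => [->//|/andP[_ ->]|->]; rewrite ?orbT.
apply/allP => x xw; have := leq_max_entry xw; rewrite forbidden_011_201.
case/or3P: uA => [/eqP->|/andP[uv _]|]; lia.
Qed.

(** The [i] letters skipped between the two maxima join [A], while the new maximum cannot be
    repeated because of 011. All right-to-left minima survive with unchanged counts. *)
Lemma inv_011_201_up w c s i : inv_011_201 w c s ->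
  inv_011_201 (rcons w ((max_entry w).+1 + i)) (c + i) (rcons s (c + i)).
Proof.
case=> A [[sA srt] Aw w0 sE app]; set m := max_entry w; set v := m.+1 + i.
have mw : m \in w by apply: mem_max_entry; case: (w) w0.
have mv : maxn m v = v by lia.
exists (A ++ iota m.+1 i); rewrite max_entry_rcons mv mem_rcons inE w0 orbT; split=> //.
- split; first by rewrite size_cat size_iota sA.
  rewrite sorted_pairwise ?pairwise_cat; last exact: ltn_trans.
  rewrite -!sorted_pairwise; try exact: ltn_trans.
  rewrite srt iota_ltn_sorted !andbT; apply/allrelP => a b /Aw[am _].
  by rewrite mem_iota; lia.
- move=> u; rewrite mem_cat mem_iota mem_rcons inE negb_or => uA.
  have uw : u \notin w.
    case/orP: uA => [/Aw[]//|um]; apply/negP => /leq_max_entry; lia.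
  by case/orP: uA => [/Aw[]|] um; rewrite uw; split; lia.
- rewrite rl_list_rcons map_rcons; congr rcons.
    rewrite (all_filterP _); last by apply/allP => x /mem_rl_list/leq_max_entry; lia.
    rewrite sE; apply/eq_in_map => u /mem_rl_list/leq_max_entry um.
    rewrite /count_lt count_cat (_ : count _ (iota _ _) = 0) ?addn0 //.
    apply/eqP; rewrite -leqn0 leqNgt -has_count; apply/hasPn => b.
    by rewrite mem_iota; lia.
  rewrite /count_lt (_ : count _ _ = size (A ++ iota m.+1 i)); first by rewrite size_cat size_iota sA.
  apply/eqP; rewrite -all_count all_cat; apply/andP; split; apply/allP => b.
    by move/Aw => [bm _]; lia.
  by rewrite mem_iota; lia.
move=> u; rewrite appendable_rcons app mem_cat mem_iota; apply/andP/idP.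
  case=> uA /allP/(_ _ w0); rewrite forbidden_011_201.
  by case/or3P: uA => [->//|->|]; rewrite ?orbT //; lia.
move=> uA; split.
  by case/or3P: uA => [->//|/orP[->|]|]; rewrite ?orbT // => um; apply/or3P/Or33; lia.
apply/allP => x xw; have := leq_max_entry xw; rewrite forbidden_011_201.
case/or3P: uA => [/eqP->|/orP[/Aw[+ _]|]|]; lia.
Qed.

Lemma sum_ext_treeB f n w c q s h z : inv_011_201 w c s -> statsB w q h z ->
  sum_ext T_011_201 n w (fun w => f (high_count w) (zero_count w)
     (size (rl_list w)) (size w - max_entry w)) =
  treeB n c q s h z (succ_weight f).
Proof.
elim: n w c q s h z => [|n IH] w c q s h z K st.
  case: K => A [_ _ _ -> _]; case: st => q0 mq wh wz.
  have r0 : 0 < size (rl_list w).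
    case: (lastP w) mq => [|u v _]; last by rewrite rl_list_rcons size_rcons.
    by rewrite /max_entry big_nil /=; lia.
  by rewrite /= wh wz -mq addKn size_map /succ_weight !prednK.
have [q0 mq _ _] := st; have [A [[sA srt] Aw w0 sE app]] := K.
pose G v := sum_ext T_011_201 n (rcons w v) (fun w => f (high_count w) (zero_count w)
     (size (rl_list w)) (size w - max_entry w)).
have split_app : \sum_(v <- iota 0 (size w).+1 | appendable T_011_201 w v) G v =
   \sum_(i < q) G ((max_entry w).+1 + i) + \sum_(i < c) G (nth 0 A i) + G 0.
  have -> : \sum_(i < c) G (nth 0 A i) = \sum_(v <- A) G v.
    by rewrite (big_nth 0) big_mkord sA.
  rewrite -(big_seq1 addn 0 G) -sum_iota -big_filter -!big_cat.
  apply: perm_big; apply: uniq_perm.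
  - by rewrite filter_uniq ?iota_uniq.
  - rewrite -catA cat_uniq iota_uniq andTb cats1 rcons_uniq (sorted_uniq ltn_trans ltnn srt) andbT.
    apply/andP; split; last by apply/negP => /Aw[]; lia.
    apply/hasPn => x; rewrite mem_rcons inE mem_iota => /orP[/eqP->|/Aw[xm _]]; lia.
  move=> x; rewrite mem_filter !mem_cat !mem_iota app inE.
  have : x \in A -> x < max_entry w by case/Aw; lia.
  by case: (x \in A) => [/(_ isT)|_]; clear -mq; lia.
rewrite [LHS]split_app /=; congr (_ + _ + _).
- apply: eq_bigr => i _; apply: IH; [exact: inv_011_201_up | exact: statsB_newmax].
- apply: eq_bigr => i _; have iA : i < size A by rewrite sA.
  have vA := mem_nth 0 iA; have [vm _] := Aw _ vA.
  apply: IH.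
    by have := inv_011_201_down srt Aw w0 app vA; rewrite count_lt_nth // -sE.
  case/andP: vm => v0 /ltnW/(statsB_low st).
  by rewrite (gtn_eqF v0) addn0.
apply: IH; first exact: inv_011_201_zero K.
by have := statsB_low st (leq0n _); rewrite addn1.
Qed.

Lemma sum_inv_avoiding_B f n :
  \sum_(e in inv_avoiding n.+1 T_011_201)
    f (high_entries e) (zeros e) (rl_minima e) (bounce e) = sumB n (succ_weight f).
Proof.
under eq_bigr do rewrite bounceE rl_minimaE zerosE high_entriesE.
rewrite (sum_inv_avoiding _ (fun w => f (high_count w) (zero_count w)
     (size (rl_list w)) (size w - max_entry w))) // -add1n sum_good_seqs good_seqs1 big_seq1.
apply: sum_ext_treeB; last by split; rewrite ?max_entry1.
exists [::]; rewrite max_entry1; split=> // v; by rewrite lt0n; case: v.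
Qed.

(** * Joint distributions as sums of indicator weights *)

Lemma card_setI_sum (S : finType) (A : {set S}) (P : pred S) :
  #|[set e in A | P e]| = \sum_(e in A) (P e : nat).
Proof.
rewrite -sum1_card big_mkcond [RHS]big_mkcond; apply: eq_bigr => e _.
by rewrite inE; case: (e \in A); case: (P e).
Qed.

Theorem theorem11 (n : nat) (hn : 0 < n) :
  #|inv_avoiding n T_010_101_120_201| = #|inv_avoiding n T_011_201|
  /\
  (forall T : seq (seq nat),
     T \in [:: T_010_101_120_201; T_010_110_120_210; T_010_100_120_210] ->
     equidistributed (inv_avoiding n T) (inv_avoiding n T_011_201)
       (fun e => (zeros e, lr_maxima e, bounce e, high_entries e))
       (fun e => (high_entries e, zeros e, rl_minima e, bounce e))
     /\
     equidistributed (inv_avoiding n T) (inv_avoiding n T)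
       (fun e => (zeros e, lr_maxima e, bounce e, high_entries e))
       (fun e => (bounce e, lr_maxima e, zeros e, high_entries e)))
  /\
  equidistributed (inv_avoiding n T_011_201) (inv_avoiding n T_011_201)
    (fun e => (high_entries e, zeros e, rl_minima e, bounce e))
    (fun e => (rl_minima e, zeros e, high_entries e, bounce e)).
Proof.
case: n hn => // n _.
have sumBC g : sumB n g = sumC n g by apply: peel_rec_unique peel_rec_sumB peel_rec_sumC.
have swapC g := peel_rec_swap n g peel_rec_sumC.
split.
  rewrite -!sum1_card (sum_inv_avoiding_B (fun _ _ _ _ => 1)).
  by rewrite (sum_inv_avoiding_classC (fun _ _ _ _ => 1)) // sumBC.
split=> [T TC|q].
  split=> q; rewrite !card_setI_sum.
    (* On C the first argument of the weight is the bounce and the third the number of zeros, so one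
       path reversal brings the zeros to the place of the high entries of the other class. *)
    rewrite (sum_inv_avoiding_classC (fun h z r b => (r, z, h, b) == q)) // swapC.
    by rewrite (sum_inv_avoiding_B (fun h z r b => (h, z, r, b) == q)) sumBC.
  rewrite (sum_inv_avoiding_classC (fun h z r b => (r, z, h, b) == q)) // swapC.
  by rewrite (sum_inv_avoiding_classC (fun h z r b => (h, z, r, b) == q)).
rewrite !card_setI_sum (sum_inv_avoiding_B (fun h z r b => (h, z, r, b) == q)).
by rewrite (sum_inv_avoiding_B (fun h z r b => (r, z, h, b) == q)) !sumBC swapC.
Qed.
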